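(* Let $\mathbb{F},\mathbb{G}:\Omega\to H_1$ be continuous Bessel families associated to $(a_2,\dots,a_n)$ for $H_1$ with respect to $(\Omega,\mu)$, with bounds $B_1$ and $B_2$ respectively, and let $m:\Omega\to\mathbb{C}$ be a measurable function. Then the continuous Bessel multiplier $M_{m,\mathbb{F},\mathbb{G}}:H_F\to H_F$ associated to $(a_2,\dots,a_n)$ of $\mathbb{F}$ and $\mathbb{G}$ with respect to $m$, defined by $$\langle M_{m,\mathbb{F},\mathbb{G}}f,g\mid a_2,\dots,a_n\rangle=\int_\Omega m(w)\,\langle f,\mathbb{F}(w)\mid a_2,\dots,a_n\rangle\,\langle\mathbb{G}(w),g\mid a_2,\dots,a_n\rangle\,d\mu(w),\quad f,g\in H_F,$$ is well defined and bounded.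
   Context: Let $n\ge 2$. An $n$-inner product on a complex vector space $H$ with $\dim H\ge n$ is a map $(x,y,x_2,\dots,x_n)\mapsto\langle x,y\mid x_2,\dots,x_n\rangle\in\mathbb{C}$ such that: (i) $\langle x_1,x_1\mid x_2,\dots,x_n\rangle\ge 0$, with equality iff $x_1,\dots,x_n$ are linearly dependent; (ii) it is invariant under permutations of $x_2,\dots,x_n$; (iii) $\langle x,y\mid x_2,\dots,x_n\rangle=\overline{\langle y,x\mid x_2,\dots,x_n\rangle}$; (iv), (v) it is linear in $x$. The induced $n$-norm is $\|x_1,x_2,\dots,x_n\|=\langle x_1,x_1\mid x_2,\dots,x_n\rangle^{1/2}$. $H$ is an $n$-Hilbert space if it is complete: every sequence $(x_k)$ with $\|x_l-x_k,e_2,\dots,e_n\|\to0$ as $l,k\to\infty$ for all $e_2,\dots,e_n\in H$ has some $x\in H$ with $\|x_k-x,e_2,\dots,e_n\|\to 0$ for all $e_2,\dots,e_n\in H$. $H_1$ is a complex $n$-Hilbert space and $a_2,\dots,a_n\in H_1$ are fixed linearly independent elements. Let $L_F=\operatorname{span}\{a_2,\dots,a_n\}$ (the subscript $F$ refers to the set $\{a_2,\dots,a_n\}$). The form $\langle x+L_F,y+L_F\rangle_F=\langle x,y\mid a_2,\dots,a_n\rangle$ is an inner product on $H_1/L_F$ (which is identified with an algebraic complement of $L_F$ in $H_1$); $H_F$ denotes its Hilbert space completion. Elements of $H_1$ are identified with their images in $H_F$, and $\langle\cdot,\cdot\mid a_2,\dots,a_n\rangle$ and $\|\cdot,a_2,\dots,a_n\|$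 also denote the inner product and norm of $H_F$. Let $(\Omega,\mu)$ be a measure space with positive measure $\mu$. A mapping $\mathbb{F}:\Omega\to H_1$ is a continuous Bessel mapping (Bessel family) associated to $(a_2,\dots,a_n)$ with bound $B$, $0<B<\infty$, if for every $f\in H_1$ the function $w\mapsto\langle f,\mathbb{F}(w)\mid a_2,\dots,a_n\rangle$ is measurable on $\Omega$ and $\int_\Omega|\langle f,\mathbb{F}(w)\mid a_2,\dots,a_n\rangle|^2\,d\mu(w)\le B\|f,a_2,\dots,a_n\|^2$ for all $f\in H_1$.
   Formalization: The function m is assumed essentially bounded as well as measurable; for merely measurable m the claim fails, e.g. counting measure on the natural numbers, F(k)=G(k)=2^{-k}e_1, m(k)=4^k, where the defining integral diverges. *)

(* Defs.v *)
From HB Require Import structures.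
From mathcomp Require Export all_boot all_order all_algebra.
From mathcomp Require Export sesquilinear complex.
From mathcomp Require Export all_classical all_reals all_analysis ess_sup_inf.
Export numFieldNormedType.Exports.

Set Implicit Arguments.
Unset Strict Implicit.
Unset Printing Implicit Defensive.

Import Order.TTheory GRing.Theory Num.Theory.

Local Open Scope classical_set_scope.
Local Open Scope complex_scope.
Local Open Scope ring_scope.

Section LinearAlgebra.
Variables (K : fieldType) (V : lmodType K).

Definition lin_indep (k : nat) (v : k.-tuple V) : Prop :=
  forall c : 'I_k -> K,
    \sum_(i < k) c i *: tnth v i = 0 -> forall i, c i = 0.

Definition in_span (k : nat) (v : k.-tuple V) (x : V) : Prop :=
  exists c : 'I_k -> K, x = \sum_(i < k) c i *: tnth v i.

Definition dim_ge (k : nat) : Prop := exists v : k.-tuple V, lin_indep v.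

End LinearAlgebra.

Section NInnerProduct.
Variables (R : realType) (n : nat) (H : lmodType R[i]).

(* [ip x y xs] is <x, y | x_2, ..., x_n>, the n - 1 last arguments being
   collected in the tuple [xs]. In the first axiom [<=] is the partial order
   of R[i], so that [0 <= z] says that z is real and nonnegative. *)
Record is_n_inner_product (ip : H -> H -> n.-1.-tuple H -> R[i]) : Prop := {
  nip_ge0 : forall x xs, 0 <= ip x x xs ;
  nip_eq0 : forall x xs, ip x x xs = 0 <-> ~ lin_indep [tuple of x :: xs] ;
  nip_perm : forall x y (xs ys : n.-1.-tuple H),
    perm_eq xs ys -> ip x y xs = ip x y ys ;
  nip_conj : forall x y xs, ip x y xs = (ip y x xs)^*%C ;
  nip_scale : forall (c : R[i]) x y xs, ip (c *: x) y xs = c * ip x y xs ;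
  nip_add : forall x x' y xs, ip (x + x') y xs = ip x y xs + ip x' y xs
}.

Definition n_norm (ip : H -> H -> n.-1.-tuple H -> R[i])
    (x : H) (xs : n.-1.-tuple H) : R :=
  Num.sqrt (complex.Re (ip x x xs)).

Record is_n_Hilbert (ip : H -> H -> n.-1.-tuple H -> R[i]) : Prop := {
  nH_dim : dim_ge H n ;
  nH_ip : is_n_inner_product ip ;
  nH_complete : forall u : nat -> H,
    (forall e : n.-1.-tuple H,
       n_norm ip (u lk.1 - u lk.2) e @[lk --> (\oo, \oo)] --> (0 : R)) ->
    exists x : H,
      forall e : n.-1.-tuple H, n_norm ip (u k - x) e @[k --> \oo] --> (0 : R)
}.

(* The Hilbert space completion of H / span(a), given up to unitary
   isomorphism: a complete normed space whose norm comes from the inner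
   product [ipF], and a linear map [J] (quotient map followed by the embedding
   into the completion) with kernel span(a), compatible with the inner
   products and with dense range. *)
Record is_quotient_completion (ip : H -> H -> n.-1.-tuple H -> R[i])
    (a : n.-1.-tuple H) (HF : completeNormedModType R[i])
    (ipF : {dot HF for @Num.conj R[i]}) (J : {linear H -> HF}) : Prop := {
  HF_norm : forall f : HF, `|f| ^+ 2 = ipF f f ;
  HF_ker : forall x : H, J x = 0 <-> in_span a x ;
  HF_isom : forall x y : H, ipF (J x) (J y) = ip x y a ;
  HF_dense : dense (range J)
}.

End NInnerProduct.

Section ComplexIntegral.
Context (d : measure_display) (T : measurableType d) (R : realType).
Variable mu : {measure set T -> \bar R}.

Definition cmeasurable (f : T -> R[i]) : Prop :=
  measurable_fun setT (fun w => complex.Re (f w)) /\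
  measurable_fun setT (fun w => complex.Im (f w)).

Definition cintegrable (f : T -> R[i]) : Prop :=
  mu.-integrable setT (fun w => (complex.Re (f w))%:E) /\
  mu.-integrable setT (fun w => (complex.Im (f w))%:E).

Definition cintegral (f : T -> R[i]) : R[i] :=
  Rintegral mu setT (fun w => complex.Re (f w)) +i*
  Rintegral mu setT (fun w => complex.Im (f w)).

Definition ess_bounded (f : T -> R[i]) : Prop :=
  (ess_sup mu (fun w => (Normc.normc (f w))%:E) < +oo)%E.

End ComplexIntegral.

Section Bessel.
Context (d : measure_display) (Omega : measurableType d) (R : realType).
Variable mu : {measure set Omega -> \bar R}.
Variables (n : nat) (H : lmodType R[i]).
Variables (ip : H -> H -> n.-1.-tuple H -> R[i]) (a : n.-1.-tuple H).

Record is_continuous_Bessel (F : Omega -> H) (B : R) : Prop := {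
  bessel_gt0 : 0 < B ;
  bessel_meas : forall f : H, cmeasurable (fun w => ip f (F w) a) ;
  bessel_le : forall f : H,
    (\int[mu]_w ((Normc.normc (ip f (F w) a)) ^+ 2)%:E
       <= (B * n_norm ip f a ^+ 2)%:E)%E
}.

Variables (HF : completeNormedModType R[i]).
Variables (ipF : {dot HF for @Num.conj R[i]}) (J : {linear H -> HF}).

(* Elements of H are seen in HF through J. The integrability is part of the
   definition: [cintegral] returns a junk value otherwise. *)
Definition is_Bessel_multiplier (m : Omega -> R[i]) (F G : Omega -> H)
    (M : HF -> HF) : Prop :=
  forall f g : HF,
    let h := fun w => m w * ipF f (J (F w)) * ipF (J (G w)) g in
    cintegrable mu h /\ ipF (M f) g = cintegral mu h.

End Bessel.

Definition bounded_operator (R : realType) (V : normedModType R[i])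
    (M : V -> V) : Prop :=
  exists K : R, forall f : V, `|M f| <= K%:C * `|f|.

(* Main.v *)
Require Import Defs.
From HB Require Import structures.
From mathcomp Require Import ring lra measurable_realfun.

Set Implicit Arguments.
Unset Strict Implicit.
Unset Printing Implicit Defensive.

Import Order.TTheory GRing.Theory Num.Theory.

Local Open Scope classical_set_scope.
Local Open Scope complex_scope.
Local Open Scope ring_scope.

(** The multiplier is the operator represented by the sesquilinear form
    Phi f g = int m <f, F> <G, g>.

    The Bessel inequalities are only assumed for elements of H_1, whose image
    is dense in H_F.  For f in H_F, take images f_k of elements of H_1 with
    f_k --> f.  The coefficients <f_k, F(w)> converge to <f, F(w)> for every w,
    so the limit is measurable and Fatou's lemma carries the Bessel inequality,
    with the same bound, to f ([bessel_dense], [bessel_completion]).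

    Almost everywhere |m| <= C, so the integrand of Phi f g is dominated by
    C (|<f, F>|^2 + |<g, G>|^2), which is integrable with integral at most
    C (B1 |f|^2 + B2 |g|^2) ([weighted_product_integrable]).  A sesquilinear
    form with such a quadratic bound is bounded, as one sees by evaluating it
    at unit vectors ([form_bound_scaling]).

    It remains to represent the form by an operator M, that is, to find for
    each f a vector M f with <M f, g> = Phi f g.  This is the Riesz
    representation theorem in the complete space H_F ([riesz]); linearity and
    uniqueness of M follow from nondegeneracy of the inner product, and its
    boundedness from |M f|^2 = Phi f (M f) ([form_operator]).

    The norm of H_F takes its values in the complex numbers; the estimates are
    carried out on the real numbers [rnorm f] and [rip f g], the norm and the
    real part of the inner product. *)

(** * Complex numbers and real preliminaries *)

Section ComplexParts.
Context {R : rcfType}.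
Implicit Types x y z : R[i].
Local Notation Re := complex.Re.
Local Notation Im := complex.Im.
Local Notation normc := Normc.normc.

Lemma Re_add x y : Re (x + y) = Re x + Re y.
Proof. by case: x; case: y. Qed.

Lemma Re_sub x y : Re (x - y) = Re x - Re y.
Proof. by case: x; case: y. Qed.

Lemma Im_add x y : Im (x + y) = Im x + Im y.
Proof. by case: x; case: y. Qed.

Lemma Re_mul x y : Re (x * y) = Re x * Re y - Im x * Im y.
Proof. by case: x; case: y. Qed.

Lemma Im_mul x y : Im (x * y) = Re x * Im y + Im x * Re y.
Proof. by case: x; case: y. Qed.

Lemma Re_conjc x : Re (Num.conj x) = Re x. Proof. by case: x. Qed.

Lemma Im_conjc x : Im (Num.conj x) = - Im x. Proof. by case: x. Qed.

Lemma normc_sqr x : normc x ^+ 2 = Re x ^+ 2 + Im x ^+ 2.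
Proof. by case: x => a b; rewrite sqr_sqrtr// addr_ge0 ?sqr_ge0. Qed.

Lemma normc_nneg x : 0 <= normc x.
Proof. by case: x => a b; exact: sqrtr_ge0. Qed.

Lemma normc_realE (t : R) : 0 <= t -> normc t%:C = t.
Proof. by move=> t0; rewrite /= expr0n addr0 sqrtr_sqr ger0_norm. Qed.

Lemma normc_conj x : normc (Num.conj x) = normc x.
Proof. by case: x => a b /=; rewrite sqrrN. Qed.

Lemma normc_ge_parts z : `|Re z| <= normc z /\ `|Im z| <= normc z.
Proof.
by split; rewrite -ler_sqr ?nnegrE ?normc_nneg// normc_sqr
  real_normK ?num_real// ?lerDl ?lerDr sqr_ge0.
Qed.

Lemma normc_le_parts z (K : R) :
  `|Re z| <= K -> `|Im z| <= K -> normc z <= K *+ 2.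
Proof.
move=> hR hI; have K0 : 0 <= K := le_trans (normr_ge0 _) hR.
rewrite -ler_sqr ?nnegrE ?normc_nneg ?mulrn_wge0// normc_sqr.
have := real_normK (num_real (Re z)); have := real_normK (num_real (Im z)).
have := normr_ge0 (Re z); have := normr_ge0 (Im z).
by move=> *; nra.
Qed.

Lemma quad_disc (A b c : R) : 0 <= c ->
  (forall t : R, 0 <= A + t * (b *+ 2) + t ^+ 2 * c) -> b ^+ 2 <= A * c.
Proof.
rewrite le_eqVlt => /predU1P[<-|c0] h; last first.
  have := h (- b / c).
  have -> : A + - b / c * (b *+ 2) + (- b / c) ^+ 2 * c = (A * c - b ^+ 2) / c.
    by field; rewrite gt_eqF.
  by rewrite pmulr_lge0 ?invr_gt0// subr_ge0.
(* c = 0: a nonconstant affine function takes the value -1. *)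
rewrite mulr0; have [->|b0] := eqVneq b 0; first by rewrite expr0n.
have := h (- (A + 1) / (b *+ 2)).
by rewrite divfK ?mulrn_eq0 ?negb_or//= mulr0 addr0; lra.
Qed.

End ComplexParts.

Lemma cvg_le_natSinv (R : realType) (u : nat -> R) (l c : R) :
  (forall k, `|l - u k| <= c * k.+1%:R^-1) -> u @ \oo --> l.
Proof.
move=> h; apply/cvgrPdist_lt => e e0.
have c0 : 0 < `|c| + 1 by rewrite ltr_wpDl.
have e2 : 0 < e / (`|c| + 1) by rewrite divr_gt0.
have [k _ hk] := near_infty_natSinv_lt (PosNum e2).
exists k => // j /= kj; apply: le_lt_trans (h _) _.
apply: (@le_lt_trans _ _ ((`|c| + 1) * j.+1%:R^-1)).
  by rewrite ler_wpM2r ?invr_ge0// (le_trans (ler_norm _)) ?lerDl.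
by have := hk j kj; rewrite /= ltr_pdivlMr// mulrC.
Qed.

Lemma limn_einf_le_cvg (R : realType) (u v : nat -> \bar R) l :
  (forall n, (u n <= v n)%E) -> v @ \oo --> l -> (limn_einf u <= l)%E.
Proof.
move=> uv vl; rewrite limn_einf_lim -(cvg_lim _ vl)//.
apply: lee_lim; [exact: is_cvg_einfs|by apply/cvg_ex; exists l|].
near=> n; apply: le_trans (uv n); apply: ereal_inf_lbound.
by exists n => //=.
Unshelve. all: by end_near. Qed.

(** * Riesz representation in a complex Hilbert space *)

Section HilbertSpace.
Context {R : realType} {V : completeNormedModType R[i]}.
Variable ip : {dot V for @Num.conj R[i]}.
Implicit Types f g h : V.

Definition rip f g : R := complex.Re (ip f g).

Definition rnorm f : R := complex.Re `|f|.

Lemma dot_linearl c f f' g : ip (c *: f + f') g = c * ip f g + ip f' g.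
Proof. exact: linearPl. Qed.

Lemma dot_linearr c f g g' : ip f (c *: g + g') = Num.conj c * ip f g + ip f g'.
Proof. exact: linearPr. Qed.

Lemma dotC f g : ip f g = Num.conj (ip g f).
Proof. by rewrite hermC/= expr0 mul1r. Qed.

Lemma ripDl f g h : rip (f + g) h = rip f h + rip g h.
Proof. by rewrite /rip linearDl Re_add. Qed.

Lemma ripDr f g h : rip h (f + g) = rip h f + rip h g.
Proof. by rewrite /rip linearDr Re_add. Qed.

Lemma ripBl f g h : rip (f - g) h = rip f h - rip g h.
Proof. by rewrite /rip linearBl Re_sub. Qed.

Lemma ripC f g : rip f g = rip g f.
Proof. by rewrite /rip dotC Re_conjc. Qed.

Lemma ripZl (t : R) f g : rip (t%:C *: f) g = t * rip f g.
Proof. by rewrite /rip linearZl_LR/= Re_mul /= mul0r subr0. Qed.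

Lemma ripZr (t : R) f g : rip f (t%:C *: g) = t * rip f g.
Proof. by rewrite ripC ripZl ripC. Qed.

(** Through this identity statements on real parts yield statements on the
    whole complex inner product. *)
Lemma Im_dot f g : complex.Im (ip f g) = rip f ('i%C *: g).
Proof.
by rewrite /rip linearZr_LR/= Re_mul /=; case: (ip f g) => a b /=; lra.
Qed.

Lemma rnormE f : `|f| = (rnorm f)%:C.
Proof. by rewrite /rnorm RRe_real// normr_real. Qed.

Lemma rnorm_ge0 f : 0 <= rnorm f.
Proof. by have := normr_ge0 f; rewrite rnormE ler0c. Qed.

Lemma rnorm0 : rnorm 0 = 0.
Proof. by rewrite /rnorm normr0. Qed.

Lemma rnorm_gt0 f : (0 < rnorm f) = (f != 0).
Proof. by rewrite -normr_gt0 rnormE ltcR. Qed.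

Lemma rnormZ c f : rnorm (c *: f) = Normc.normc c * rnorm f.
Proof.
apply: complexI; rewrite -rnormE normrZ rnormE rmorphM /=.
by congr (_ * _); rewrite normc_def; case: c.
Qed.

Lemma rnormB f g : rnorm (f - g) = rnorm (g - f).
Proof. by rewrite /rnorm distrC. Qed.

Lemma ler_rnormD f g : rnorm (f + g) <= rnorm f + rnorm g.
Proof. by have := ler_normD f g; rewrite !rnormE -rmorphD lecR. Qed.

(** A Cauchy criterion at the rate 1/k, which is all that [riesz_real] needs.
    The limit is approached at indices that are also large, so that errors
    tending to 0 with the index can be controlled at the same time. *)
Lemma rnorm_complete (u : nat -> V) :
  (forall k l, (k <= l)%N -> rnorm (u k - u l) <= 2 * k.+1%:R^-1) ->
  exists y, forall e, 0 < e -> exists k, rnorm (u k - y) < e /\ k.+1%:R^-1 < e.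
Proof.
move=> hu.
have : cvg (u @ \oo).
  apply/cauchy_cvgP/cauchy_exP => e e0.
  (* A positive complex number is real. *)
  have e0' : 0 < complex.Re e by move: e0; rewrite ltcE => /andP[].
  have eE : e = (complex.Re e)%:C by rewrite RRe_real// gtr0_real.
  have e2 : 0 < complex.Re e / 2 by rewrite divr_gt0.
  have [k _ hk] := near_infty_natSinv_lt (PosNum e2).
  exists (u k); exists k => // l /= kl.
  rewrite -ball_normE/= rnormE eE ltcR (le_lt_trans (hu _ _ kl))//.
  by have := hk k (leqnn k); rewrite /= ltr_pdivlMr// mulrC.
move=> /cvg_ex[y /cvgrPdist_lt uy]; exists y => e e0.
have [|k0 _ h0] := uy e%:C; first by rewrite ltcR.
have [k1 _ h1] := near_infty_natSinv_lt (PosNum e0).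
exists (maxn k0 k1); split.
  by have := h0 (maxn k0 k1) (leq_maxl _ _); rewrite /= rnormE ltcR rnormB.
by have := h1 (maxn k0 k1) (leq_maxr _ _).
Qed.

Hypothesis ip_norm : forall f, `|f| ^+ 2 = ip f f.

Lemma rip_sqr f : rip f f = rnorm f ^+ 2.
Proof. by rewrite /rip -ip_norm rnormE expr2 Re_mul/= mulr0 subr0 expr2. Qed.

Lemma rnorm_sqrDZ f g (t : R) : rnorm (f + t%:C *: g) ^+ 2 =
  rnorm f ^+ 2 + t * (rip f g *+ 2) + t ^+ 2 * rnorm g ^+ 2.
Proof. by rewrite -!rip_sqr !(ripDl, ripDr, ripZl, ripZr) (ripC g f); ring. Qed.

Lemma rip_cauchy_schwarz f g : `|rip f g| <= rnorm f * rnorm g.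
Proof.
rewrite -ler_sqr ?nnegrE ?mulr_ge0 ?rnorm_ge0// real_normK ?num_real// exprMn.
apply: quad_disc; first exact: sqr_ge0.
by move=> t; rewrite -rnorm_sqrDZ sqr_ge0.
Qed.

Lemma dot_nondegenerate f f' : (forall g, ip f g = ip f' g) -> f = f'.
Proof.
move=> h; apply/eqP; rewrite -subr_eq0 -normr_eq0 -sqrf_eq0 ip_norm.
have -> : ip (f - f') (f - f') = ip f (f - f') - ip f' (f - f').
  exact: linearBl.
by rewrite h subrr.
Qed.

Section RealRiesz.
Variables (L : V -> R) (K : R).
Hypothesis LD : forall f g, L (f + g) = L f + L g.
Hypothesis LZ : forall (t : R) f, L (t%:C *: f) = t * L f.
Hypothesis Lle : forall f, `|L f| <= K * rnorm f.

(** A vector that minimises q f = |f|^2 - 2 L f represents L, since the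
    derivative of q at x in the direction g is 2 (<x, g> - L g).  If q x is only
    within e^2 of the infimum of q, then t |-> q (x + t g) - q x + e^2 is a
    nonnegative quadratic polynomial, and its discriminant shows that x
    represents L up to e. *)
Lemma riesz_approx e : 0 < e ->
  exists x, forall g, `|rip x g - L g| <= e * rnorm g.
Proof.
move=> e0; pose q f := rnorm f ^+ 2 - L f *+ 2.
have hinf : has_inf (range q).
  split; first by exists (q 0), 0.
  exists (- K ^+ 2) => _ [f _ <-]; rewrite /q.
  have := Lle f; rewrite ler_norml => /andP[_ h].
  by have := sqr_ge0 (rnorm f - K); rewrite sqrrB; lra.
have e2 : 0 < e ^+ 2 by rewrite exprn_gt0.
have [_ [x _ <-] qx] := inf_adherent e2 hinf.
exists x => g.
rewrite -ler_sqr ?nnegrE ?mulr_ge0 ?rnorm_ge0 ?(ltW e0)//.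
rewrite real_normK ?num_real// exprMn.
apply: quad_disc => [|t]; first exact: sqr_ge0.
have : inf (range q) <= q (x + t%:C *: g).
  by apply: ge_inf; [case: hinf | exists (x + t%:C *: g)].
by move: qx; set s := inf _; rewrite /q rnorm_sqrDZ LD LZ; lra.
Qed.

(** Two vectors x and x' representing L up to e and e' satisfy
    |x - x'| <= e + e', by comparing both functionals at x - x'.  Hence vectors
    representing L up to 1/k form a Cauchy sequence, and its limit
    represents L. *)
Lemma riesz_real : exists y, forall g, L g = rip y g.
Proof.
have /choice[u hu] k :
    exists x, forall g, `|rip x g - L g| <= k.+1%:R^-1 * rnorm g.
  by apply: riesz_approx; rewrite invr_gt0.
have [k l kl|y hy] := rnorm_complete (u := u).
  have [->|] := eqVneq (u k - u l) 0; first by rewrite rnorm0 mulr_ge0// invr_ge0.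
  rewrite -rnorm_gt0 => d0; rewrite -(ler_pM2r d0) -expr2 -rip_sqr ripBl.
  set d := u k - u l in d0 *.
  have := hu k d; have := hu l d.
  rewrite !ler_norml => /andP[h1 h2] /andP[h3 h4].
  have : l.+1%:R^-1 * rnorm d <= k.+1%:R^-1 * rnorm d.
    by rewrite ler_pM2r// lef_pV2 ?posrE// ler_nat ltnS.
  by move: (l.+1%:R^-1) (k.+1%:R^-1) h1 h2 h3 h4 => a b; lra.
exists y => g; apply/eqP; rewrite eq_sym -subr_eq0 -normr_eq0.
rewrite eq_le normr_ge0 andbT.
apply/ler_addgt0Pr => e e0; rewrite add0r.
(* Two errors of size e' |g| add up to at most e when e' = e / (2 |g| + 1). *)
have g0 : 0 < rnorm g *+ 2 + 1 by have := rnorm_ge0 g; lra.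
have [|k [h1 h2]] := hy (e / (rnorm g *+ 2 + 1)); first by rewrite divr_gt0.
have h3 := hu k g.
have h4 := rip_cauchy_schwarz (u k - y) g.
have h5 : rnorm (u k - y) * rnorm g <= e / (rnorm g *+ 2 + 1) * rnorm g.
  by rewrite ler_wpM2r ?rnorm_ge0// ltW.
have h6 : k.+1%:R^-1 * rnorm g <= e / (rnorm g *+ 2 + 1) * rnorm g.
  by rewrite ler_wpM2r ?rnorm_ge0// ltW.
have h7 : e / (rnorm g *+ 2 + 1) * (rnorm g *+ 2) <= e.
  by rewrite -mulrA ler_piMr ?(ltW e0)// mulrC ler_pdivrMr// mul1r; lra.
have -> : rip y g - L g = (rip (u k) g - L g) - rip (u k - y) g.
  by rewrite ripBl; ring.
apply: le_trans (ler_normB _ _) _.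
by move: (k.+1%:R^-1) (e / _) h3 h5 h6 h7 => a b; lra.
Qed.

End RealRiesz.

(** A complex linear functional is determined by its real part, because
    Im (phi f) = - Re (phi (i f)); so the vector representing Re phi
    represents phi. *)
Lemma riesz (phi : {scalar V}) (K : R) :
  (forall f, Normc.normc (phi f) <= K * rnorm f) ->
  exists y, forall f, phi f = ip f y.
Proof.
move=> hK.
have [|||y hy] := @riesz_real (fun f => complex.Re (phi f)) K.
- by move=> f g; rewrite linearD Re_add.
- by move=> t f; rewrite linearZ/= Re_mul/= mul0r subr0.
- by move=> f; apply: le_trans (hK f); exact: (normc_ge_parts _).1.
exists y => f; apply/eqP; rewrite eq_complex; apply/andP; split; apply/eqP.
  by rewrite hy ripC.
have := hy ('i%C *: f); rewrite ripC /rip linearZl_LR linearZ/= !Re_mul/=.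
by rewrite !mul0r !mul1r !sub0r => /oppr_inj.
Qed.

(** * Bounded sesquilinear forms and operators *)

Section Form.
Variable Phi : V -> V -> R[i].
Hypothesis PhiL : forall c f f' g, Phi (c *: f + f') g = c * Phi f g + Phi f' g.
Hypothesis PhiR : forall c f g g',
  Phi f (c *: g + g') = Num.conj c * Phi f g + Phi f g'.

(** At unit vectors the assumed bound is P + Q, and both sides of the conclusion
    are homogeneous in f and in g. *)
Lemma form_bound_scaling (P Q : R) :
  (forall f g,
    Normc.normc (Phi f g) <= P * rnorm f ^+ 2 + Q * rnorm g ^+ 2) ->
  forall f g, Normc.normc (Phi f g) <= (P + Q) * (rnorm f * rnorm g).
Proof.
move=> PQ.
have P0l g : Phi 0 g = 0.
  by have := PhiL (-1) 0 0 g; rewrite scaler0 addr0 mulN1r addNr.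
have P0r f : Phi f 0 = 0.
  by have := PhiR (-1) f 0 0; rewrite scaler0 addr0 rmorphN1 mulN1r addNr.
have ZL c f g : Phi (c *: f) g = c * Phi f g.
  by rewrite -[c *: f]addr0 PhiL P0l addr0.
have ZR c f g : Phi f (c *: g) = Num.conj c * Phi f g.
  by rewrite -[c *: g]addr0 PhiR P0r addr0.
have unit (f : V) : f != 0 ->
    exists f', [/\ f = (rnorm f)%:C *: f' & rnorm f' = 1].
  rewrite -rnorm_gt0 => f0.
  exists (((rnorm f)^-1)%:C *: f); split.
    by rewrite scalerA -rmorphM mulfV ?gt_eqF// scale1r.
  by rewrite rnormZ normc_realE ?invr_ge0 ?rnorm_ge0// mulVf// gt_eqF.
move=> f g.
have [->|f0] := eqVneq f 0.
  by rewrite P0l Normc.normc0 rnorm0 mul0r mulr0.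
have [->|g0] := eqVneq g 0.
  by rewrite P0r Normc.normc0 rnorm0 !mulr0.
have [f' [fE f1]] := unit f f0; have [g' [gE g1]] := unit g g0.
rewrite {1}fE {1}gE ZL ZR !Normc.normcM normc_conj.
rewrite !normc_realE ?rnorm_ge0// mulrA mulrC.
rewrite ler_wpM2r ?mulr_ge0 ?rnorm_ge0//.
by have := PQ f' g'; rewrite f1 g1 expr1n !mulr1.
Qed.

Lemma form_operator (K : R) : 0 <= K ->
  (forall f g, Normc.normc (Phi f g) <= K * (rnorm f * rnorm g)) ->
  exists M : {linear V -> V}, (forall f g, ip (M f) g = Phi f g) /\
    (forall f, rnorm (M f) <= K * rnorm f).
Proof.
move=> K0 PhiK.
have /choice[M hM] : forall f, exists y, forall g, ip y g = Phi f g.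
  (* Phi f is conjugate linear, so Riesz is applied to its conjugate. *)
  move=> f; pose phi g := Num.conj (Phi f g).
  have phi_lin : scalar phi.
    by move=> c g g'; rewrite /phi PhiR rmorphD rmorphM /= conjCK.
  pose phiL : {scalar V} :=
    HB.pack phi (GRing.isLinear.Build _ _ _ _ phi phi_lin).
  have [|y hy] := riesz (phi := phiL) (K := K * rnorm f).
    by move=> g; rewrite -mulrA /= /phi normc_conj; exact: PhiK.
  by exists y => g; rewrite dotC -hy; exact: conjCK.
have M_lin : linear M.
  move=> c f f'; apply: dot_nondegenerate => g.
  by rewrite hM PhiL dot_linearl !hM.
pose ML : {linear V -> V} := HB.pack M (GRing.isLinear.Build _ _ _ _ M M_lin).
exists ML; split => // f; rewrite /=.
have [->|] := eqVneq (M f) 0; first by rewrite rnorm0 mulr_ge0 ?rnorm_ge0.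
rewrite -rnorm_gt0 => Mf0; rewrite -(ler_pM2r Mf0) -mulrA -expr2 -rip_sqr.
apply: le_trans (PhiK f (M f)); rewrite /rip hM.
exact: le_trans (ler_norm _) (normc_ge_parts _).1.
Qed.

End Form.

End HilbertSpace.

(** * Complex integrals *)

Section ComplexIntegrals.
Context (d : measure_display) (T : measurableType d) (R : realType).
Variable mu : {measure set T -> \bar R}.

Definition energy (f : T -> R[i]) : \bar R :=
  (\int[mu]_w ((Normc.normc (f w)) ^+ 2)%:E)%E.

Lemma energy_conj (f : T -> R[i]) :
  energy (fun w => Num.conj (f w)) = energy f.
Proof. by apply: eq_integral => w _; rewrite normc_conj. Qed.

Lemma measurable_normc_sqr (f : T -> R[i]) : cmeasurable f ->
  measurable_fun setT (fun w => Normc.normc (f w) ^+ 2).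
Proof.
move=> [mR mI]; under eq_fun do rewrite normc_sqr.
by apply: measurable_funD; apply: measurable_funX.
Qed.

Lemma cmeasurableM (f g : T -> R[i]) : cmeasurable f -> cmeasurable g ->
  cmeasurable (fun w => f w * g w).
Proof.
move=> [fR fI] [gR gI]; split.
  under eq_fun do rewrite Re_mul.
  by apply: measurable_funB; apply: measurable_funM.
under eq_fun do rewrite Im_mul.
by apply: measurable_funD; apply: measurable_funM.
Qed.

Lemma cmeasurable_conj (f : T -> R[i]) : cmeasurable f ->
  cmeasurable (fun w => Num.conj (f w)).
Proof.
move=> [fR fI]; split; first by under eq_fun do rewrite Re_conjc.
by under eq_fun do rewrite Im_conjc; exact: measurable_funN.
Qed.

Lemma cintegral_linear (c : R[i]) (f g : T -> R[i]) :
  cintegrable mu f -> cintegrable mu g ->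
  cintegral mu (fun w => c * f w + g w) = c * cintegral mu f + cintegral mu g.
Proof.
move=> [fR fI] [gR gI]; rewrite /cintegral.
have iZ (t : R) (k : T -> R) : mu.-integrable setT (fun w => (k w)%:E) ->
    mu.-integrable setT (EFin \o (fun w => t * k w)).
  by move=> ik; exact: (integrableZl measurableT t ik).
have iD (k l : T -> R) : mu.-integrable setT (EFin \o k) ->
    mu.-integrable setT (EFin \o l) ->
    mu.-integrable setT (EFin \o (fun w => k w + l w)).
  by move=> ik il; exact: (integrableD measurableT ik il).
have -> : (fun w => complex.Re (c * f w + g w)) = (fun w =>
    complex.Re c * complex.Re (f w) +
    ((- complex.Im c) * complex.Im (f w) + complex.Re (g w))).
  by apply/funext => w; rewrite Re_add Re_mul mulNr addrA.
have -> : (fun w => complex.Im (c * f w + g w)) = (fun w =>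
    complex.Re c * complex.Im (f w) +
    (complex.Im c * complex.Re (f w) + complex.Im (g w))).
  by apply/funext => w; rewrite Im_add Im_mul addrA.
rewrite !RintegralD//; try by [exact: iZ | apply: iD => //; exact: iZ].
rewrite !RintegralZl//; case: c => p q /=.
by congr (_ +i* _); rewrite ?mulNr addrA.
Qed.

Lemma dominated_integrable (k b : T -> R) (C U : R) :
  measurable_fun setT k -> measurable_fun setT b -> 0 <= C ->
  (forall w, 0 <= b w) -> (\int[mu]_w (b w)%:E <= U%:E)%E ->
  {ae mu, forall w, `|k w| <= C * b w} ->
  mu.-integrable setT (EFin \o k) /\ `|Rintegral mu setT k| <= C * U.
Proof.
move=> mk mb C0 b0 bU kb.
have kC : (\int[mu]_w `|(k w)%:E| <= (C * U)%:E)%E.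
  apply: (@le_trans _ _ (\int[mu]_w (C%:E * (b w)%:E))%E).
    apply: ae_ge0_le_integral => //.
    - by apply: measurableT_comp => //; exact/measurable_EFinP.
    - by move=> w _; rewrite -EFinM lee_fin mulr_ge0.
    - by apply: measurable_funeM; exact/measurable_EFinP.
    - by apply: filterS kb => w kw _; rewrite -EFinM lee_fin.
  rewrite ge0_integralZl_EFin//.
  - by rewrite EFinM lee_wpmul2l.
  - by move=> w _; rewrite lee_fin.
  - exact/measurable_EFinP.
have ik : mu.-integrable setT (EFin \o k).
  apply/integrableP; split; first exact/measurable_EFinP.
  exact: le_lt_trans kC (ltry _).
split => //; rewrite -lee_fin EFin_normr_Rintegral//.
by apply: le_trans kC; apply: le_abse_integral => //; exact/measurable_EFinP.
Qed.

Lemma ess_bounded_bound (m : T -> R[i]) : ess_bounded mu m ->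
  exists2 C : R, 0 <= C & {ae mu, forall w, Normc.normc (m w) <= C}.
Proof.
move=> /(ess_supr_bounded (f := fun w => Normc.normc (m w)))[C hC].
by exists `|C| => //; apply: filterS hC => w h; exact: le_trans h (ler_norm _).
Qed.

(** The elementary |u v| <= |u|^2 + |v|^2 is used instead of the
    Cauchy-Schwarz inequality for integrals; the resulting non-homogeneous
    estimate is what [form_bound_scaling] takes.  The factor 2 comes from
    bounding the real and imaginary parts of the integral separately. *)
Lemma weighted_product_integrable (m u v : T -> R[i]) (C U W : R) :
  cmeasurable m -> cmeasurable u -> cmeasurable v ->
  0 <= C -> {ae mu, forall w, Normc.normc (m w) <= C} ->
  (energy u <= U%:E)%E -> (energy v <= W%:E)%E ->
  cintegrable mu (fun w => m w * u w * v w) /\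
  Normc.normc (cintegral mu (fun w => m w * u w * v w)) <= (C * (U + W)) *+ 2.
Proof.
move=> mm mu_ mv C0 hC hU hW.
pose b w := Normc.normc (u w) ^+ 2 + Normc.normc (v w) ^+ 2.
have mb : measurable_fun setT b.
  by apply: measurable_funD; exact: measurable_normc_sqr.
have b0 w : 0 <= b w by rewrite addr_ge0 ?sqr_ge0.
have bU : (\int[mu]_w (b w)%:E <= (U + W)%:E)%E.
  under eq_integral do rewrite /b EFinD.
  rewrite ge0_integralD//.
  - by rewrite EFinD leeD.
  - by move=> w _; rewrite lee_fin sqr_ge0.
  - exact/measurable_EFinP/measurable_normc_sqr.
  - by move=> w _; rewrite lee_fin sqr_ge0.
  - exact/measurable_EFinP/measurable_normc_sqr.
have hb : {ae mu, forall w, Normc.normc (m w * u w * v w) <= C * b w}.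
  apply: filterS hC => w hw; rewrite !Normc.normcM -mulrA.
  apply: ler_pM; rewrite ?mulr_ge0 ?normc_nneg// /b.
  have := normc_nneg (u w); have := normc_nneg (v w).
  by move: (Normc.normc (u w)) (Normc.normc (v w)) => x y; nra.
have [hR hI] := cmeasurableM (cmeasurableM mm mu_) mv.
have [iR bR] := dominated_integrable hR mb C0 b0 bU
  (filterS (fun w => le_trans (normc_ge_parts _).1) hb).
have [iI bI] := dominated_integrable hI mb C0 b0 bU
  (filterS (fun w => le_trans (normc_ge_parts _).2) hb).
by split; [split | exact: normc_le_parts].
Qed.

(** * Bessel mappings in the completion *)

Section BesselExtension.
Context {V : completeNormedModType R[i]} (ip : {dot V for @Num.conj R[i]}).
Hypothesis ip_norm : forall f, `|f| ^+ 2 = ip f f.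

Lemma dense_approx (D : set V) (f : V) : dense D ->
  exists x : nat -> V, forall k, D (x k) /\ rnorm (f - x k) <= k.+1%:R^-1.
Proof.
move=> dD.
suff /choice[x hx] : forall k, exists x, D x /\ rnorm (f - x) <= k.+1%:R^-1.
  by exists x.
move=> k; have e0 : 0 < ((k.+1%:R^-1 : R)%:C) by rewrite ltcR invr_gt0.
have [|x [bx Dx]] := dD _ _ (ball_open f ((k.+1%:R^-1 : R)%:C)).
  by exists f; exact: ballxx.
exists x; split => //.
by move: bx; rewrite -ball_normE/= rnormE ltcR => /ltW.
Qed.

(** The vectors F w need not be bounded in norm, so the coefficients of an
    approximating sequence converge pointwise but not uniformly in w.  Fatou's
    lemma asks for nothing more, and it preserves the constant B. *)
Lemma bessel_dense (D : set V) (F : T -> V) (B : R) : dense D ->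
  (forall f, D f -> cmeasurable (fun w => ip f (F w))) ->
  (forall f, D f -> (energy (fun w => ip f (F w)) <= (B * rnorm f ^+ 2)%:E)%E) ->
  forall f, cmeasurable (fun w => ip f (F w)) /\
    (energy (fun w => ip f (F w)) <= (B * rnorm f ^+ 2)%:E)%E.
Proof.
move=> dD hm hle f; have [x hx] := dense_approx f dD.
have cvgrip v : rip ip (x k) v @[k --> \oo] --> rip ip f v.
  apply: (@cvg_le_natSinv _ _ _ (rnorm v)) => k.
  rewrite -ripBl (le_trans (rip_cauchy_schwarz ip_norm _ _))// mulrC.
  by rewrite ler_wpM2l ?rnorm_ge0//; case: (hx k).
have cvgIm v : complex.Im (ip (x k) v) @[k --> \oo] --> complex.Im (ip f v).
  by rewrite Im_dot; under eq_fun do rewrite Im_dot; exact: cvgrip.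
have mf : cmeasurable (fun w => ip f (F w)).
  split.
    apply: (measurable_fun_cvg (h := fun k w => complex.Re (ip (x k) (F w)))).
      by move=> k; case: (hm _ (hx k).1).
    by move=> w _; exact: cvgrip.
  apply: (measurable_fun_cvg (h := fun k w => complex.Im (ip (x k) (F w)))).
    by move=> k; case: (hm _ (hx k).1).
  by move=> w _; exact: cvgIm.
split => //.
have cvgsqr v : (Normc.normc (ip (x k) v) ^+ 2)%:E @[k --> \oo] -->
    (Normc.normc (ip f v) ^+ 2)%:E.
  apply: cvg_EFin; first by near=> k.
  rewrite normc_sqr /comp /=; under eq_fun do rewrite normc_sqr !expr2.
  rewrite !expr2; apply: cvgD; apply: cvgM;
    [exact: cvgrip..|exact: cvgIm|exact: cvgIm].
have -> : energy (fun w => ip f (F w)) =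
  (\int[mu]_w limn_einf (fun k => (Normc.normc (ip (x k) (F w)) ^+ 2)%:E))%E.
  by apply: eq_integral => w _; rewrite (cvg_limn_einf_sup (cvgsqr (F w))).
apply: le_trans (fatou mu measurableT
  (f := fun k w => (Normc.normc (ip (x k) (F w)) ^+ 2)%:E) _ _) _.
- move=> k; apply/measurable_EFinP/measurable_normc_sqr.
  exact: hm (hx k).1.
- by move=> k w _; rewrite lee_fin sqr_ge0.
apply: limn_einf_le_cvg.
  by move=> k; exact: hle _ (hx k).1.
apply: cvg_EFin; first by near=> k.
rewrite /comp/=; apply: cvgM; first exact: cvg_cst.
have cn : rnorm (x k) @[k --> \oo] --> rnorm f.
  apply: (@cvg_le_natSinv _ _ _ 1) => k; rewrite mul1r.
  apply: le_trans (hx k).2; rewrite ler_norml; apply/andP; split.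
    by have := ler_rnormD (x k - f) f; rewrite subrK rnormB; lra.
  by have := ler_rnormD (f - x k) (x k); rewrite subrK; lra.
by under eq_fun do rewrite expr2; rewrite expr2; exact: cvgM.
Unshelve. all: by end_near. Qed.

End BesselExtension.

End ComplexIntegrals.

Lemma bessel_completion (R : realType) (n : nat) (H : lmodType R[i])
    (ip : H -> H -> n.-1.-tuple H -> R[i]) (a : n.-1.-tuple H)
    (HF : completeNormedModType R[i]) (ipF : {dot HF for @Num.conj R[i]})
    (J : {linear H -> HF}) (hHF : is_quotient_completion ip a ipF J)
    (d : measure_display) (Omega : measurableType d)
    (mu : {measure set Omega -> \bar R}) (F : Omega -> H) (B : R) :
  is_continuous_Bessel mu ip a F B ->
  forall f, cmeasurable (fun w => ipF f (J (F w))) /\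
    (energy mu (fun w => ipF f (J (F w))) <= (B * rnorm f ^+ 2)%:E)%E.
Proof.
case: hHF => hN _ hJ hD [_ hm hle].
apply: (bessel_dense hN hD) => _ [x _ <-].
  by under eq_fun do rewrite hJ; exact: hm.
have <- : n_norm ip x a ^+ 2 = rnorm (J x) ^+ 2.
  by rewrite -(rip_sqr hN) sqr_sqrtr /rip ?hJ// -hJ -/(rip ipF _ _) (rip_sqr hN)
    sqr_ge0.
by rewrite /energy; under eq_integral do rewrite hJ; exact: hle.
Qed.

(** * The Bessel multiplier *)

Theorem theorem3p12 (R : realType) (n : nat) (hn : (2 <= n)%N)
    (H1 : lmodType R[i]) (ip : H1 -> H1 -> n.-1.-tuple H1 -> R[i])
    (hH1 : is_n_Hilbert ip)
    (a : n.-1.-tuple H1) (ha : lin_indep a)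
    (HF : completeNormedModType R[i]) (ipF : {dot HF for @Num.conj R[i]})
    (J : {linear H1 -> HF}) (hHF : is_quotient_completion ip a ipF J)
    (d : measure_display) (Omega : measurableType d)
    (mu : {measure set Omega -> \bar R})
    (F G : Omega -> H1) (B1 B2 : R)
    (hF : is_continuous_Bessel mu ip a F B1)
    (hG : is_continuous_Bessel mu ip a G B2)
    (m : Omega -> R[i]) (hm : cmeasurable m) (hmb : ess_bounded mu m) :
  exists M : {linear HF -> HF},
    [/\ is_Bessel_multiplier mu ipF J m F G M,
        (forall M' : HF -> HF,
           is_Bessel_multiplier mu ipF J m F G M' -> M' =1 M)
      & bounded_operator M].
Proof.
have hN := HF_norm hHF.
have [C C0 hC] := ess_bounded_bound hmb.
pose u f w := ipF f (J (F w)); pose v g w := ipF (J (G w)) g.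
pose Phi f g := cintegral mu (fun w => m w * u f w * v g w).
have hh f g : cintegrable mu (fun w => m w * u f w * v g w) /\
    Normc.normc (Phi f g) <= (C * (B1 * rnorm f ^+ 2 + B2 * rnorm g ^+ 2)) *+ 2.
  have [mu_ eu] := bessel_completion hHF hF f.
  have [mv_ ev] := bessel_completion hHF hG g.
  have vE : v g = (fun w => Num.conj (ipF g (J (G w)))).
    by apply/funext => w; rewrite /v dotC.
  apply: weighted_product_integrable => //; rewrite vE.
    exact: cmeasurable_conj.
  by rewrite energy_conj.
have PL c f f' g : Phi (c *: f + f') g = c * Phi f g + Phi f' g.
  rewrite /Phi -(cintegral_linear _ (hh f g).1 (hh f' g).1).
  congr (cintegral mu _); apply/funext => w.
  by rewrite /u dot_linearl; ring.
have PR c f g g' : Phi f (c *: g + g') = Num.conj c * Phi f g + Phi f g'.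
  rewrite /Phi -(cintegral_linear _ (hh f g).1 (hh f g').1).
  congr (cintegral mu _); apply/funext => w.
  by rewrite /v dot_linearr; ring.
have PB : forall f g, Normc.normc (Phi f g) <=
    (C * B1 *+ 2 + C * B2 *+ 2) * (rnorm f * rnorm g).
  apply: (form_bound_scaling PL PR) => f g.
  by apply: le_trans (hh f g).2 _; lra.
have K0 : 0 <= C * B1 *+ 2 + C * B2 *+ 2.
  by rewrite addr_ge0 ?mulrn_wge0 ?mulr_ge0 ?(ltW (bessel_gt0 hF))
    ?(ltW (bessel_gt0 hG)).
have [M [hM Mle]] := form_operator hN PL PR K0 PB.
exists M; split.
- by move=> f g; split; [exact: (hh f g).1 | exact: hM].
- move=> M' hM' f; apply: (dot_nondegenerate hN) => g.
  by rewrite hM; case: (hM' f g).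
- exists (C * B1 *+ 2 + C * B2 *+ 2) => f.
  by rewrite !rnormE -rmorphM lecR.
Qed.
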